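(* Let $t\ge 5$ be an integer, and let $(B_k)_{k\ge 0}$ and $(F_k)_{k\ge 0}$ be the integer sequences (depending on $d=t-3$) defined in the context. Every $P_t$-free graph $G$ with $\omega(G)=k\ge 1$ has a clique-reducing set $R\subseteq V(G)$ with $\chi(G\setminus R)\le B_k$. Consequently, $\chi(G)\le F_k$.
   Context: All graphs are finite and simple. $P_t$ is the path on $t$ vertices; a graph is $P_t$-free if it has no induced subgraph isomorphic to $P_t$. $\chi$ and $\omega$ denote chromatic number and clique number; both are $0$ for the empty (null) graph. $G[S]$ is the subgraph induced on $S$, and $G\setminus R$ is the graph obtained by deleting the vertices in $R$. For a nonempty graph $H$, a set $R\subseteq V(H)$ is clique-reducing in $H$ if $\omega(H[R])<\omega(H)$. Let $d=t-3\ge 2$. Define integers $p_j$ ($j\ge0$) and $L_m$ ($m\ge0$) by \[ p_0=0,\quad p_1=1,\quad p_{j+1}=d\,p_j-p_{j-1}\ (j\ge1),\qquad L_m=\sum_{j=1}^{m+1}p_j\ (m\ge0). \] Define integers $F_k,B_k$ by $F_0=B_0=0$, $F_1=B_1=1$ and, for $k\ge2$, \[ T_k=\min\Bigl\{B_{k-1},\ \min_{0\le m\le k-2}\bigl(B_m+L_mF_{k-m-1}-p_mF_{k-m-2}\bigr)\Bigr\}, \] \[ B_k=(d-1)F_{k-1}+T_k,\qquad F_k=F_{k-1}+B_k . \] *)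

(* Defs.v *)
From mathcomp Require Import all_boot all_order all_algebra.
From mathcomp Require Import zify.

Set Implicit Arguments.
Unset Strict Implicit.
Unset Printing Implicit Defensive.

Import Order.TTheory GRing.Theory Num.Theory.

Record sgraph := SGraph {
  vertex :> finType;
  adj : rel vertex;
  adj_sym : symmetric adj;
  adj_irrefl : irreflexive adj }.

Section Induced.
Variables (G : sgraph) (S : {set G}).
Definition induced_adj : rel {x : G | x \in S} := fun x y => adj (val x) (val y).
Lemma induced_sym : symmetric induced_adj.
Proof. by move=> x y; apply: adj_sym. Qed.
Lemma induced_irrefl : irreflexive induced_adj.
Proof. by move=> x; apply: adj_irrefl. Qed.
Definition induced : sgraph := SGraph induced_sym induced_irrefl.
End Induced.

Definition delete (G : sgraph) (R : {set G}) : sgraph := induced (~: R).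

Section Path.
Variable t : nat.
Definition path_adj : rel 'I_t := fun i j => (i.+1 == j :> nat) || (j.+1 == i :> nat).
Lemma path_sym : symmetric path_adj.
Proof. by move=> i j; rewrite /path_adj orbC. Qed.
Lemma path_irrefl : irreflexive path_adj.
Proof. by move=> i; rewrite /path_adj orbb; apply/eqP => /esym /n_Sn. Qed.
Definition path_graph : sgraph := SGraph path_sym path_irrefl.
End Path.

Definition isomorphic (G H : sgraph) : Prop :=
  exists2 f : G -> H, bijective f & forall x y, adj (f x) (f y) = adj x y.

Definition path_free (t : nat) (G : sgraph) : Prop :=
  forall S : {set G}, ~ isomorphic (induced S) (path_graph t).

Definition clique (G : sgraph) (K : {set G}) : bool :=
  [forall x in K, forall y in K, (x != y) ==> adj x y].

Definition omega (G : sgraph) : nat := \max_(K : {set G} | clique K) #|K|.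

Definition colorable (G : sgraph) (n : nat) : bool :=
  [exists c : {ffun G -> 'I_n}, forall x, forall y, adj x y ==> (c x != c y)].

Lemma colorable_card (G : sgraph) : exists n, colorable G n.
Proof.
exists #|G|; apply/existsP; exists [ffun x => enum_rank x].
apply/forallP => x; apply/forallP => y; apply/implyP => xy.
rewrite !ffunE (inj_eq enum_rank_inj); apply: contraTneq xy => ->.
by rewrite adj_irrefl.
Qed.

Definition chi (G : sgraph) : nat := ex_minn (colorable_card G).

Definition clique_reducing (G : sgraph) (R : {set G}) : bool :=
  (omega (induced R) < omega G)%N.

Local Open Scope ring_scope.

Section Sequences.
Variable d : nat.

Fixpoint p (j : nat) : int :=
  match j with
  | 0 => 0
  | 1 => 1
  | (j'.+1 as i).+1 => d%:Z * p i - p j'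
  end.

Definition L (m : nat) : int := \sum_(1 <= j < m.+2) p j.

(* T_k for k >= 2, as a function of the earlier terms of F and B; the bound
   m < k.-1 is 0 <= m <= k - 2, and all the nat subtractions are exact. *)
Definition T_of (F B : nat -> int) (k : nat) : int :=
  \big[Num.min/B k.-1]_(m < k.-1)
    (B m + L m * F (k - m - 1)%N - p m * F (k - m - 2)%N).

Definition B_of (F B : nat -> int) (k : nat) : int :=
  (d%:Z - 1) * F k.-1 + T_of F B k.

(* The list of the pairs (F_j, B_j) for 0 <= j <= k: the recursion is
   course-of-values. The recurrences are FE, BE and TE below. *)
Fixpoint FB_table (k : nat) : seq (int * int) :=
  if k is k'.+1 then
    let s := FB_table k' in
    let F j := (nth (0, 0) s j).1 in
    let B j := (nth (0, 0) s j).2 in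
    let b := if k' is 0 then 1 else B_of F B k in
    rcons s (F k' + b, b)
  else [:: (0, 0)].

Definition F (k : nat) : int := (nth (0, 0) (FB_table k) k).1.
Definition B (k : nat) : int := (nth (0, 0) (FB_table k) k).2.
Definition T (k : nat) : int := T_of F B k.

Lemma size_FB_table k : size (FB_table k) = k.+1.
Proof. by elim: k => //= k IH; rewrite size_rcons IH. Qed.

Lemma nth_FB_table k j : (j <= k)%N ->
  nth (0, 0) (FB_table k) j = (F j, B j).
Proof.
rewrite -surjective_pairing; elim: k => [|k IH].
  by rewrite leqn0 => /eqP ->.
rewrite leq_eqVlt => /orP[/eqP -> //|jk].
by rewrite /= nth_rcons size_FB_table jk IH.
Qed.

Lemma F0 : F 0 = 0. Proof. by []. Qed.
Lemma B0 : B 0 = 0. Proof. by []. Qed.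
Lemma F1 : F 1 = 1. Proof. by []. Qed.
Lemma B1 : B 1 = 1. Proof. by []. Qed.

Lemma TE k : T k = \big[Num.min/B k.-1]_(m < k.-1)
  (B m + L m * F (k - m - 1)%N - p m * F (k - m - 2)%N).
Proof. by []. Qed.

Lemma BE k : (2 <= k)%N -> B k = (d%:Z - 1) * F k.-1 + T k.
Proof.
case: k => [|[|k]] // _; rewrite {1}/B.
have -> : FB_table k.+2 = rcons (FB_table k.+1)
    ((nth (0, 0) (FB_table k.+1) k.+1).1 +
       B_of (fun j => (nth (0, 0) (FB_table k.+1) j).1)
            (fun j => (nth (0, 0) (FB_table k.+1) j).2) k.+2,
     B_of (fun j => (nth (0, 0) (FB_table k.+1) j).1)
          (fun j => (nth (0, 0) (FB_table k.+1) j).2) k.+2) by [].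
rewrite nth_rcons size_FB_table ltnn eqxx /B_of /T /T_of [k.+2.-1]/=.
rewrite nth_FB_table //; congr (_ + _); apply: eq_bigr => m _.
by rewrite !nth_FB_table //; have := ltn_ord m; lia.
Qed.

Lemma FE k : (1 <= k)%N -> F k = F k.-1 + B k.
Proof.
case: k => [|k] // _.
by rewrite /F /B /= nth_rcons size_FB_table ltnn eqxx nth_FB_table.
Qed.

End Sequences.

(* Main.v *)
Require Import Defs.
From mathcomp Require Import all_boot all_order all_algebra.
From mathcomp Require Import zify ring.

Set Implicit Arguments.
Unset Strict Implicit.
Unset Printing Implicit Defensive.

Import Order.TTheory GRing.Theory Num.Theory.

Local Open Scope ring_scope.

(* Gyarfas' path argument, run inside the vertex subsets of a fixed graph.
   Grow an induced path whose last vertex v is the only one with neighbours in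
   the current connected set C; each new vertex costs the colours of a
   neighbourhood.  When the path has d = t - 3 vertices, P_t-freeness makes
   every vertex of N = N_C(v) complete or anticomplete to every component D of
   C \ N, so N together with a clique-reducing subset of each D is
   clique-reducing: this is the term B_(k-1) of T_k.
   For the term indexed by m, colour separately the set S of those u in N that
   are complete to some D with omega(D) > m; then the D with omega(D) > m may
   go entirely into the reducing set, and the other ones cost B_m.  A vertex u
   of S has a neighbour x (in D) with omega(N_S(x)) <= r = k - m - 1, so in S
   the path argument can start from x instead of u, at the cost F_r of N_S(x)
   instead of a full neighbourhood.  By induction on q this colours a subset of
   S of clique number r + q with E_q = L_q F_r - p_q F_(r-1) colours, since
   E_(q+1) - E_q = F_r + (d - 2) E_q + (E_q - E_(q-1)). *)

(** * The integer sequences *)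

Section Sequences.
Variable d : nat.

Lemma pSS j : p d j.+2 = d%:Z * p d j.+1 - p d j.
Proof. by []. Qed.

Lemma LS m : L d m.+1 = L d m + p d m.+2.
Proof. by rewrite /L big_nat_recr. Qed.

(** The second difference of [p] at [j] is [(d - 2) p_j]; summing over [j] from 1 to [m + 1] gives
    the identity. *)
Lemma p_diff m : p d m.+2 - p d m.+1 = 1 + (d%:Z - 2) * L d m.
Proof.
elim: m => [|m IH]; first by rewrite /L big_nat1 /=; ring.
by rewrite LS mulrDr addrA -IH pSS [p d m.+2]pSS; ring.
Qed.

(** A minimum is one of its arguments. The bracketed difference is the cost [E_m] of the
    overview. *)
Lemma T_ind (P : int -> Prop) k : (2 <= k)%N -> P (B d k.-1) ->
  (forall m, (m.+2 <= k)%N ->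
     P (B d m + (L d m * F d (k - m - 1) - p d m * F d (k - m - 2)))) ->
  P (T d k).
Proof.
move=> k2 PB Pm; rewrite TE; apply: (big_ind P) => //.
  by move=> x y Px Py; rewrite minEle; case: ifP.
by move=> [m mk] _ /=; rewrite -addrA; apply: Pm; lia.
Qed.

Hypothesis d2 : (2 <= d)%N.

Lemma p_le_L m : 0 <= p d m <= L d m.
Proof.
(* By [p_diff], monotonicity of [p] rests on [0 <= L d m], so the bounds are proved together. *)
suff [h0 h1 h2] : [/\ 0 <= p d m, p d m <= p d m.+1 & p d m.+1 <= L d m].
  by rewrite h0 (le_trans h1).
elim: m => [|m [h0 h1 h2]]; first by rewrite /L big_nat1.
have L0 := le_trans (le_trans h0 h1) h2.
split; first exact: le_trans h1.
  by rewrite -subr_ge0 p_diff addr_ge0 // mulr_ge0 // subr_ge0 lez_nat.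
by rewrite LS lerDr.
Qed.

(** [F_r >= F_(r-1)] because [B_r >= 0], so [p_le_L] makes each bracket nonnegative. Only indices
    below [k] are assumed, for use inside the induction of [FB_ge0]. *)
Lemma T_ge0 k : (2 <= k)%N ->
  (forall j, (j < k)%N -> 0 <= F d j /\ 0 <= B d j) -> 0 <= T d k.
Proof.
move=> k2 IH; apply: (@T_ind (fun z => 0 <= z)) => // [|m mk].
  by have [] := IH k.-1 ltac:(lia).
have [_ Bm] := IH m ltac:(lia); have [Fr0 _] := IH (k - m - 2)%N ltac:(lia).
have [_ Br0] := IH (k - m - 1)%N ltac:(lia).
have e : F d (k - m - 1)%N = F d (k - m - 2)%N + B d (k - m - 1)%N.
  by rewrite FE; [congr (F d _ + _); lia|lia].
have /andP[p0 pL] := p_le_L m.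
by rewrite addr_ge0 // subr_ge0; apply: ler_pM => //; rewrite e lerDl.
Qed.

Lemma FB_ge0 k : 0 <= F d k /\ 0 <= B d k.
Proof.
elim/ltn_ind: k => -[|[|k]] // IH.
have [F0 _] := IH k.+1 (ltnSn _).
have Bk : 0 <= B d k.+2.
  by rewrite BE // addr_ge0 ?T_ge0 // mulr_ge0 // subr_ge0 lez_nat ltnW.
by split=> //; rewrite FE // addr_ge0.
Qed.

(** Beyond the first step, [B_(k+1) >= (d - 1) F_k >= F_k >= B_k]. *)
Lemma B_mono k : B d k <= B d k.+1.
Proof.
case: k => [|k]; first by case: (FB_ge0 1).
have [Fk _] := FB_ge0 k; have [Fk1 _] := FB_ge0 k.+1.
rewrite (@BE d k.+2) //= ler_wpDr //; first by apply: T_ge0 => // j _; exact: FB_ge0.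
apply: le_trans (_ : F d k.+1 <= _); first by rewrite FE //= lerDr.
by apply: ler_peMl => //; rewrite lerBrDr lez_nat.
Qed.

End Sequences.

(** * Colourings and cliques of vertex subsets *)

Section Graph.
Variable G : sgraph.
Implicit Types (A C D K N R X Y : {set G}) (u v x y : G) (s : seq G).

Definition omega_in A : nat := \max_(K : {set G} | clique K && (K \subset A)) #|K|.

Definition nbr A v : {set G} := [set x in A | adj v x].

(** The bound is an integer, like [F] and [B]. The conjunct [0 <= z] constrains the empty set too,
    so that bounds can be added. *)
Definition colorable_in A (z : int) : Prop :=
  0 <= z /\ exists c : G -> nat, (forall x, x \in A -> (c x)%:Z < z) /\
    (forall x y, x \in A -> y \in A -> adj x y -> c x != c y).

(* Connectedness as the absence of a cut, so that the edge leaving a proper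
   nonempty subset is directly available. *)
Definition connected_in A : Prop := forall X, X \subset A -> X != set0 -> X != A ->
  exists x y, [/\ x \in X, y \in A :\: X & adj x y].

Definition adj_in A : rel G := fun x y => [&& x \in A, y \in A & adj x y].

Definition component A x : {set G} := [set y in A | connect (adj_in A) x y].

Fixpoint induced_path s : bool :=
  if s is x :: s1 then
    (if s1 is y :: s2 then
       adj x y && all (fun z => (x != z) && ~~ adj x z) s2 else true) && induced_path s1
  else true.

Lemma cliqueP K :
  reflect {in K &, forall x y, x != y -> adj x y} (clique K).
Proof.
apply: (iffP forall_inP) => [h x y xK yK xy | h x xK].
  by have /forall_inP/(_ y yK)/implyP := h x xK; apply.
by apply/forall_inP => y yK; apply/implyP => /h; apply.
Qed.

Lemma clique_sub K X : clique K -> X \subset K -> clique X.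
Proof. by move=> /cliqueP h /subsetP s; apply/cliqueP => x y /s xK /s; exact: h. Qed.

Lemma cliqueU K X : clique K -> clique X ->
  {in K & X, forall x y, adj x y} -> clique (K :|: X).
Proof.
move=> /cliqueP hK /cliqueP hX h; apply/cliqueP => x y.
rewrite !inE => /orP[xK|xX] /orP[yK|yX] xy; [exact: hK|exact: h| |exact: hX].
by rewrite adj_sym; apply: h.
Qed.

Lemma clique1 x : clique [set x].
Proof. by apply/cliqueP => y z /set1P -> /set1P ->; rewrite eqxx. Qed.

Lemma omega_in_leP A n :
  reflect (forall K, clique K -> K \subset A -> #|K| <= n)%N (omega_in A <= n)%N.
Proof.
apply: (iffP (bigop.bigmax_leqP _ _ _)) => h K; first by move=> ? ?; apply: h; apply/andP.
by move=> /andP[]; exact: h.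
Qed.

Lemma omega_in_ge A K : clique K -> K \subset A -> (#|K| <= omega_in A)%N.
Proof. by move: (leqnn (omega_in A)) => /omega_in_leP; exact. Qed.

Lemma omega_in_ex A : exists K, [/\ clique K, K \subset A & #|K| = omega_in A].
Proof.
have c0 : clique (set0 : {set G}) by apply/cliqueP => x y; rewrite inE.
have : (0 < #|[pred K : {set G} | clique K && (K \subset A)]|)%N.
  by apply/card_gt0P; exists set0; rewrite !inE c0 sub0set.
case/(eq_bigmax_cond (fun K : {set G} => #|K|)) => K /andP[kK KA] e.
by exists K.
Qed.

Lemma omega_inS A C : A \subset C -> (omega_in A <= omega_in C)%N.
Proof. by move=> s; apply/omega_in_leP => K k KA; apply: omega_in_ge k (subset_trans KA s). Qed.

Lemma omega_in0 : omega_in set0 = 0%N.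
Proof.
apply/eqP; rewrite -leqn0; apply/omega_in_leP => K _; rewrite subset0 => /eqP ->.
by rewrite cards0.
Qed.

Lemma omega_in1 x : omega_in [set x] = 1%N.
Proof.
apply/eqP; rewrite eqn_leq; apply/andP; split.
  by apply/omega_in_leP => K _ /subset_leq_card; rewrite cards1.
by have := omega_in_ge (clique1 x) (subxx _); rewrite cards1.
Qed.

Lemma omega_in_gt0 A : A != set0 -> (0 < omega_in A)%N.
Proof. by case/set0Pn => x xA; rewrite -(omega_in1 x); apply: omega_inS; rewrite sub1set. Qed.

Lemma omega_in_join A X Y : X \subset A -> Y \subset A ->
  {in X & Y, forall x y, adj x y} -> (omega_in X + omega_in Y <= omega_in A)%N.
Proof.
move=> XA YA h; case: (omega_in_ex X) (omega_in_ex Y) => K [kK KX <-] [K' [kK' KY <-]].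
have K0 : K :&: K' = set0.
  apply/setP => x; rewrite !inE; apply/negP => /andP[xK xK'].
  by have := h _ _ (subsetP KX _ xK) (subsetP KY _ xK'); rewrite adj_irrefl.
rewrite -cardsUI K0 cards0 addn0; apply: omega_in_ge.
  by apply: cliqueU => // x y xK yK; apply: h; [exact: (subsetP KX)|exact: (subsetP KY)].
by rewrite subUset (subset_trans KX XA) (subset_trans KY YA).
Qed.

Lemma omega_in_nbr A C v : v \in A -> C \subset A -> (omega_in (nbr C v) < omega_in A)%N.
Proof.
move=> vA CA; rewrite -add1n -(omega_in1 v); apply: omega_in_join; first by rewrite sub1set.
  by apply: subset_trans CA; apply/subsetP => x; rewrite inE => /andP[].
by move=> x y /set1P -> ; rewrite inE => /andP[].
Qed.

Lemma colorable_inS A C z z' : A \subset C -> z <= z' -> colorable_in C z -> colorable_in A z'.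
Proof.
move=> /subsetP s zz' [z0 [c [c1 c2]]]; split; first exact: le_trans zz'.
exists c; split=> [x /s xC | x y /s xC /s yC]; last exact: c2.
exact: lt_le_trans (c1 x xC) zz'.
Qed.

Lemma colorable_in0 z : 0 <= z -> colorable_in set0 z.
Proof. by move=> z0; split=> //; exists (fun=> 0%N); split=> x; rewrite inE. Qed.

Lemma colorable_inU A C a c : colorable_in A a -> colorable_in C c ->
  colorable_in (A :|: C) (a + c).
Proof.
move=> [a0 [f [f1 f2]]] [c0 [g [g1 g2]]]; split; first exact: addr_ge0.
exists (fun x => if x \in A then f x else `|a|%N + g x)%N; split=> [x|x y].
  rewrite inE; case: ifP => [xA _|_ /= xC]; first by have := f1 x xA; lia.
  by have := g1 x xC; lia.
rewrite !inE; case: ifP => [xA _|_ /= xC]; case: ifP => [yA _|_ /= yC] h.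
- exact: f2.
- by have := f1 x xA; lia.
- by have := f1 y yA; lia.
- by rewrite eqn_add2l; exact: g2.
Qed.

(** * Connected components of a vertex subset *)

Lemma adj_in_sym A : connect_sym (adj_in A).
Proof. by apply: sym_connect_sym => x y; rewrite /adj_in adj_sym andbCA. Qed.

Lemma component_sub A x : component A x \subset A.
Proof. by apply/subsetP => y; rewrite inE => /andP[]. Qed.

Lemma component_refl A x : x \in A -> x \in component A x.
Proof. by move=> xA; rewrite inE xA connect0. Qed.

Lemma component_eq A x y : y \in component A x -> component A y = component A x.
Proof.
rewrite inE => /andP[yA xy]; apply/setP => z; rewrite !inE.
by rewrite (same_connect (@adj_in_sym A) xy).
Qed.

Lemma component_adj A x y z : y \in component A x -> z \in A -> adj y z -> z \in component A x.
Proof.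
move=> yx zA yz; have := yx; rewrite !inE zA => /andP[yA xy] /=.
by apply: connect_trans xy (connect1 _); rewrite /adj_in yA zA.
Qed.

Lemma component_connected A x : connected_in (component A x).
Proof.
move=> X sX /set0Pn[a aX] XC.
have /subsetPn[b bC bX] : ~~ (component A x \subset X).
  by apply: contraNN XC => h; rewrite eqEsubset sX.
have aC := subsetP sX a aX.
case: (boolP [exists y in X, exists z in component A x :\: X, adj y z]).
  by case/exists_inP => y yX /exists_inP[z zX yz]; exists y, z.
(* With no edge leaving it, [X] is closed under adjacency in [A], so it contains [b] along with
   [a]. *)
move=> nex; have cl : closed (adj_in A) (mem X).
  apply: intro_closed; first exact: adj_in_sym.
  move=> y z /and3P[yA zA yz] yX; apply: contraNT nex => zX.
  apply/exists_inP; exists y => //; apply/exists_inP; exists z => //.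
  by rewrite inE zX; apply: component_adj zA yz; apply: (subsetP sX).
have ab : connect (adj_in A) a b.
  by move: bC; rewrite -(component_eq aC) inE => /andP[].
have e : (a \in X) = (b \in X) by exact: closed_connect cl _ _ ab.
by rewrite -e aX in bX.
Qed.

Lemma clique_component A K x : clique K -> K \subset A -> x \in K -> K \subset component A x.
Proof.
move=> /cliqueP k /subsetP KA xK; apply/subsetP => y yK.
have [<-|xy] := eqVneq x y; first exact/component_refl/KA.
by apply: component_adj (KA _ yK) (k _ _ xK yK xy); exact/component_refl/KA.
Qed.

(** Local choices are glued into one set. The choice is indexed by the component as a set, so that
    all its vertices share it. *)
Lemma component_choice A (P : {set G} -> {set G} -> Prop) :
  (forall x, x \in A -> exists2 R : {set G}, R \subset component A x & P (component A x) R) ->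
  exists2 R : {set G}, R \subset A & forall x, x \in A -> P (component A x) (R :&: component A x).
Proof.
move=> h.
have h' : forall D, exists R : {set G},
    forall x, x \in A -> D = component A x -> R \subset D /\ P D R.
  move=> D; case: (boolP [exists x in A, D == component A x]).
    case/exists_inP => x xA /eqP ->; case: (h x xA) => R RD PR.
    by exists R.
  move=> ne; exists set0 => x xA e; case/negP: ne.
  by apply/exists_inP; exists x => //; apply/eqP.
case: (fin_all_exists h') => f hf.
exists [set y in A | y \in f (component A y)] => [|x xA].
  by apply/subsetP => y; rewrite inE => /andP[].
have [sf Pf] := hf _ x xA erefl.
suff -> : [set y in A | y \in f (component A y)] :&: component A x = f (component A x) by [].
apply/setP => y; rewrite inE inE; case: (boolP (y \in component A x)) => yx.
  by rewrite (component_eq yx) (subsetP (component_sub A x) _ yx) andbT.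
by rewrite andbF; apply/esym/negbTE; apply: contraNN yx; exact: subsetP.
Qed.

(** No edge joins two components, so all of them can use the same [z] colours. *)
Lemma colorable_in_component A Y z : Y \subset A -> 0 <= z ->
  (forall x, x \in A -> colorable_in (Y :&: component A x) z) -> colorable_in Y z.
Proof.
move=> YA z0 h; split=> //.
have h' : forall D, exists c : {ffun G -> nat},
   forall x, x \in A -> D = component A x ->
   (forall x, x \in Y :&: D -> (c x)%:Z < z) /\
   (forall x y, x \in Y :&: D -> y \in Y :&: D -> adj x y -> c x != c y).
  move=> D; case: (boolP [exists x in A, D == component A x]).
    case/exists_inP => x xA /eqP ->; case: (h x xA) => _ [c [c1 c2]].
    by exists [ffun y => c y] => _ _ _; split=> [y yD|y w yD wD yw]; rewrite !ffunE;
      [exact: c1|exact: c2].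
  move=> ne; exists [ffun=> 0%N] => x xA e; case/negP: ne.
  by apply/exists_inP; exists x => //; apply/eqP.
case: (fin_all_exists h') => c hc.
exists (fun x => c (component A x) x); split=> [x xY|x y xY yY xy].
  have xA := subsetP YA _ xY.
  by have [c1 _] := hc _ x xA erefl; apply: c1; rewrite inE xY component_refl.
have [xA yA] := (subsetP YA _ xY, subsetP YA _ yY).
have yx : y \in component A x by apply: component_adj yA xy; exact: component_refl.
have [_ c2] := hc _ x xA erefl.
by rewrite (component_eq yx); apply: c2; rewrite // inE ?xY ?yY ?component_refl.
Qed.

Lemma omega_in_component A Y q : Y \subset A ->
  (forall x, x \in A -> (omega_in (Y :&: component A x) <= q)%N) -> (omega_in Y <= q)%N.
Proof.
move=> YA h; apply/omega_in_leP => K kK KY.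
have [->|/set0Pn[x xK]] := eqVneq K set0; first by rewrite cards0.
have KA := subset_trans KY YA.
apply: leq_trans (h x (subsetP KA x xK)); apply: omega_in_ge => //.
by rewrite subsetI KY; exact: clique_component.
Qed.

(** The target [q] is absolute, not relative to [omega_in C]: it is inherited from the ambient set
    while [C] shrinks. *)
Definition reducible C q b : Prop :=
  exists R, [/\ R \subset C, (omega_in R <= q)%N & colorable_in (C :\: R) b].

Lemma setD_componentI A R x : (A :\: R) :&: component A x = component A x :\: (R :&: component A x).
Proof.
apply/setP => y; rewrite !inE; case: (y \in A) => //=; last by rewrite !andbF.
by case: (y \in R); case: (connect _ _ _).
Qed.

Lemma reducible_component A q b : 0 <= b ->
  (forall x, x \in A -> reducible (component A x) q b) -> reducible A q b.
Proof.
move=> b0 h.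
have [|R RA hR] := @component_choice A (fun D R => (omega_in R <= q)%N /\ colorable_in (D :\: R) b).
  by move=> x /h[R [? ? ?]]; exists R.
exists R; split=> //; first by apply: omega_in_component RA _ => x /hR[].
apply: (@colorable_in_component A); rewrite ?subsetDl // => x /hR[_].
by rewrite setD_componentI.
Qed.

(** One step of the path argument: [c] colours pay for the neighbourhood of [v], and each remaining
    component [X] is entered through a vertex [u] of it, the next vertex of the path. *)
Lemma reducible_delete_nbr C v q b c : connected_in C -> (0 < q)%N -> 0 <= b ->
  v \in C \/ nbr C v != set0 -> colorable_in (nbr C v) c ->
  (forall X u, X \subset C -> connected_in X -> v \notin X -> {in X, forall x, ~~ adj v x} ->
     u \in nbr C v -> u \notin X -> nbr X u != set0 -> reducible X q b) ->
  reducible C q (c + b).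
Proof.
move=> cC q0 b0 hv hc h.
suff [R [RA oR cR]] : reducible (C :\: nbr C v) q b.
  exists R; split=> //; first exact: subset_trans RA (subsetDl _ _).
  apply: colorable_inS (colorable_inU hc cR) => //; apply/subsetP => x.
  by rewrite !inE; case: (x \in C); case: (x \in R); case: (adj v x).
set A := C :\: nbr C v; apply: reducible_component => // x xA.
have Xv y : y \in component A x -> ~~ adj v y.
  by move/(subsetP (component_sub _ _)); rewrite !inE => /andP[h1 yC]; move: h1; rewrite yC.
have xX := component_refl xA.
have XC : component A x \subset C by apply: subset_trans (component_sub _ _) (subsetDl _ _).
(* All neighbours of [v] in [C] were deleted, so its own component is [[set v]], which may be kept
   whole since [0 < q]. *)
case: (boolP (v \in component A x)) => vX.
  have -> : component A x = [set v].
    apply/esym/eqP; apply: contraT => ne.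
    have [||y [z [/set1P-> /setDP[zX _] yz]]] := component_connected _ _ ne.
    - by rewrite sub1set.
    - by apply/set0Pn; exists v; rewrite inE.
    by rewrite (negPf (Xv z zX)) in yz.
  by exists [set v]; rewrite omega_in1 setDv; split=> //; exact: colorable_in0.
have ne0 : component A x != set0 by apply/set0Pn; exists x.
have neC : component A x != C.
  apply: contraNneq vX => e; case: hv => [|/set0Pn[u]]; first by rewrite e.
  by rewrite inE -e => /andP[/Xv/negPf->].
have [y [u [yX /setDP[uC uX] yu]]] := cC _ XC ne0 neC.
(* A neighbour of [X] outside the deleted set would belong to [X]. *)
have uN : u \in nbr C v.
  apply: contraNT uX => uN; apply: component_adj yX _ yu.
  by rewrite inE uN.
apply: h uN uX _ => //; first exact: component_connected.
by apply/set0Pn; exists y; rewrite inE yX adj_sym.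
Qed.

(** * Growing an induced path *)

Definition far s C : Prop :=
  {in s, forall z, z \notin C /\ {in C, forall x, ~~ adj z x}}.

Lemma far_sub s C X : X \subset C -> far s C -> far s X.
Proof.
move=> XC h z /h[zC hz]; split; first by apply: contraNN zC; exact: subsetP.
by move=> x /(subsetP XC); exact: hz.
Qed.

Lemma far_cons s C v : v \notin C -> {in C, forall x, ~~ adj v x} -> far s C ->
  far (v :: s) C.
Proof. by move=> vC hv h z; rewrite inE => /predU1P[->//|/h]. Qed.

Lemma far_induced_path u v s C : u \in C -> adj v u -> far s C -> induced_path (v :: s) ->
  induced_path [:: u, v & s].
Proof.
move=> uC vu h p; apply/andP; split; last exact: p.
rewrite adj_sym vu; apply/allP => z /h[zC hz].
by rewrite adj_sym hz // andbT; apply: contraNneq zC => <-.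
Qed.

(* [v :: s] is the induced path grown so far, listed from its last vertex [v];
   [n] is its number of vertices. Its first vertices need not lie in [A]. *)
Definition endgame A q n b : Prop := forall v s C, (size s).+1 = n ->
  induced_path (v :: s) -> far s C -> v \in A -> C \subset A -> v \notin C -> connected_in C ->
  nbr C v != set0 -> reducible C q b.

(** Each of the [j] missing vertices costs one neighbourhood of a vertex of [A], which has clique
    number at most [q] and hence takes [E] colours. *)
Lemma endgame_shift A q n j b E : (omega_in A <= q.+1)%N -> (0 < q)%N -> 0 <= b -> 0 <= E ->
  (forall X, X \subset A -> (omega_in X <= q)%N -> colorable_in X E) ->
  endgame A q (n + j) b -> endgame A q n (j%:Z * E + b).
Proof.
move=> oA q0 b0 E0 hE; elim: j n => [|j IH] n eb; first by rewrite mul0r add0r -[n]addn0.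
move=> v s C sn p fC vA CA vC cC nC.
have -> : j.+1%:Z * E + b = E + (j%:Z * E + b) by rewrite -addn1 PoszD mulrDl mul1r addrAC addrC.
apply: (@reducible_delete_nbr _ v) => //; first by rewrite addr_ge0 ?mulr_ge0.
- by right.
- apply: hE; last by rewrite -ltnS; apply: leq_trans (omega_in_nbr vA CA) oA.
  by apply: subset_trans CA; apply/subsetP => x; rewrite inE => /andP[].
move=> X u XC cX vX hX; rewrite inE => /andP[uC vu] uX nX.
apply: (IH n.+1 _ u (v :: s)) => //=; rewrite ?addSnnS ?sn //.
- exact: (@far_induced_path _ _ _ C).
- by apply: far_cons => //; exact: far_sub fC.
- exact: (subsetP CA).
- exact: subset_trans CA.
Qed.

(** Paying [c] for the neighbourhood of [x] gives a path on two vertices; [d - 2] more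
    neighbourhoods bring it to [d]. Allowing [x] outside [A] permits a start with a cheap
    neighbourhood. *)
Lemma reducible_of_endgame A q d b c E x : (2 <= d)%N -> connected_in A ->
  (omega_in A <= q.+1)%N -> (0 < q)%N -> 0 <= b -> 0 <= E ->
  (forall X, X \subset A -> (omega_in X <= q)%N -> colorable_in X E) ->
  endgame A q d b ->
  x \in A \/ nbr A x != set0 -> colorable_in (nbr A x) c ->
  reducible A q (c + ((d - 2)%:Z * E + b)).
Proof.
move=> d2 cA oA q0 b0 E0 hE eb hx hc.
apply: (@reducible_delete_nbr _ x) => //; first by rewrite addr_ge0 ?mulr_ge0.
move=> X u XA cX xX hX; rewrite inE => /andP[uA xu] uX nX.
have := endgame_shift oA q0 b0 E0 hE; move/(_ 2 (d - 2)%N); rewrite subnKC // => /(_ eb).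
move/(_ u [:: x] X erefl); apply=> //; first by rewrite /= adj_sym xu.
by apply: far_cons.
Qed.

(** * The end of the path: homogeneous components *)

Section PathFree.
Variable d : nat.
Hypothesis nopath : forall s, induced_path s -> size s <> d.+3.

(** If [u] had both a neighbour and a non-neighbour in [D], connectedness would give an edge [a b]
    of [D] with [a] adjacent to [u] and [b] not. Then [b, a, u, v, s] is an induced path on [d + 3]
    vertices. *)
Lemma homogeneous v s C D u y z : (size s).+1 = d ->
  induced_path (v :: s) -> far s C -> v \notin C -> connected_in D -> D \subset C :\: nbr C v ->
  u \in nbr C v -> y \in D -> adj u y -> z \in D -> adj u z.
Proof.
move=> sd p fC vC cD DC uN yD uy zD; apply: contraT => uz.
have [|||a [b [aX bD ab]]] := cD (nbr D u).
- by apply/subsetP => x; rewrite inE => /andP[].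
- by apply/set0Pn; exists y; rewrite inE yD.
- by apply: contraNneq uz => e; move: zD; rewrite -{1}e inE => /andP[].
move: uN aX bD; rewrite !inE => /andP[uC vu] /andP[aD ua] /andP[ub bD].
rewrite bD /= in ub.
have [aC av] : a \in C /\ ~~ adj v a.
  by move/(subsetP DC): aD; rewrite !inE => /andP[]; case: (a \in C).
have [bC bv] : b \in C /\ ~~ adj v b.
  by move/(subsetP DC): bD; rewrite !inE => /andP[]; case: (b \in C).
have fs w x : w \in C -> x \in s -> (w != x) && ~~ adj w x.
  move=> wC /fC[xC hx]; rewrite adj_sym hx // andbT.
  by apply: contraNneq xC => <-.
case: (@nopath [:: b, a, u, v & s]); last by rewrite /= sd.
have nv w : w \in C -> w != v by move=> wC; apply: contraNneq vC => <-.
have bu : b != u by apply: contraNneq bv => ->.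
have Hs w : w \in C -> all (fun x => (w != x) && ~~ adj w x) s.
  by move=> wC; apply/allP => x; exact: fs.
move: p => /= ->; rewrite !Hs // !nv // bu (adj_sym b a) ab (adj_sym b u) ub.
by rewrite (adj_sym b v) bv (adj_sym a u) ua (adj_sym a v) av (adj_sym u v) vu.
Qed.

(** The reducing set is [N :\: S] together with the chosen [R] in each component. A clique outside
    [N] stays in one component [D], and by homogeneity its part in [N] is complete to [D]. *)
Lemma reducible_homogeneous A q v s C (S : {set G}) (e b : int) :
  (omega_in A <= q.+1)%N -> (size s).+1 = d ->
  induced_path (v :: s) -> far s C -> v \in A -> C \subset A -> v \notin C -> connected_in C ->
  nbr C v != set0 -> 0 <= b -> S \subset nbr C v -> colorable_in S e ->
  (forall x, let D := component (C :\: nbr C v) x in x \in C :\: nbr C v -> (omega_in D <= q)%N ->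
     exists2 R : {set G}, R \subset D & ((omega_in R < omega_in D)%N \/
       {in nbr C v :\: S & D, forall u y, ~~ adj u y}) /\ colorable_in (D :\: R) b) ->
  reducible C q (e + b).
Proof.
move=> oA sd p fC vA CA vC cC nC b0 SN cS h.
set N := nbr C v in nC SN h *; set A' := (C :\: N) in h.
have NC : N \subset C by apply/subsetP => x; rewrite inE => /andP[].
have hom D u y z := @homogeneous v s C D u y z sd p fC vC.
(* Connectedness of [C] attaches each component to some [u] in [N], which is then complete to it;
   this bounds the clique number of the component by [q]. *)
have hcomplete x : x \in A' -> exists2 u, u \in N & {in component A' x, forall y, adj u y}.
  move=> xA; have [|||y [u [yX /setDP[uC uX] yu]]] := cC (component A' x).
  - exact: subset_trans (component_sub _ _) (subsetDl _ _).
  - by apply/set0Pn; exists x; exact: component_refl.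
  - apply: contraTneq nC => eX; rewrite negbK; apply/eqP/setP => z; rewrite [RHS]inE.
    apply/negP => zN; have := subsetP NC z zN; rewrite -eX => /(subsetP (component_sub _ _)).
    by rewrite inE zN.
  have uN : u \in N.
    by apply: contraNT uX => uN; apply: component_adj yX _ yu; rewrite inE uN.
  exists u => // z zX; apply: (@hom (component A' x) u y) => //.
  - exact: component_connected.
  - exact: component_sub.
  - by rewrite adj_sym.
have oD x : x \in A' -> (omega_in (component A' x) <= q)%N.
  move=> xA; have [u uN hu] := hcomplete x xA; rewrite -ltnS.
  apply: leq_trans oA; rewrite -add1n -(omega_in1 u); apply: omega_in_join.
  - by rewrite sub1set; apply: subsetP CA _ _; exact: subsetP uN.
  - by apply: subset_trans CA; apply: subset_trans (component_sub _ _) (subsetDl _ _).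
  by move=> y z /set1P-> ; exact: hu.
have [|R RA hR] := @component_choice A' (fun D R => ((omega_in R < omega_in D)%N \/
       {in N :\: S & D, forall u y, ~~ adj u y}) /\ colorable_in (D :\: R) b).
  by move=> x xA; exact: h (oD x xA).
have RC : R \subset C by apply: subset_trans RA (subsetDl _ _).
exists ((N :\: S) :|: R); split.
- by rewrite subUset RC (subset_trans (subsetDl _ _) NC).
- apply/omega_in_leP => K kK KR.
  have KC : K \subset C.
    by apply: subset_trans KR _; rewrite subUset RC (subset_trans (subsetDl _ _) NC).
  (* A clique inside [N] can be enlarged by [v], so it has at most [q] vertices. *)
  have [KN|/subsetPn[x xK xN]] := boolP (K \subset N).
    rewrite -ltnS; apply: leq_trans oA; apply: leq_trans (omega_in_nbr vA CA).
    by rewrite ltnS; exact: omega_in_ge.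
  have xA : x \in A' by rewrite inE xN; exact: (subsetP KC).
  have K2D : K :\: N \subset component A' x.
    apply: clique_component; rewrite ?in_setD ?xN ?xK //.
      by apply: clique_sub kK _; exact: subsetDl.
    exact: setSD.
  have K2R : K :\: N \subset R :&: component A' x.
    rewrite subsetI K2D andbT; apply/subsetP => y /setDP[/(subsetP KR)].
    by rewrite in_setU in_setD => /orP[/andP[_ ->]|].
  have o2 : (#|K :\: N| <= omega_in (R :&: component A' x))%N.
    by apply: omega_in_ge K2R; apply: clique_sub kK _; exact: subsetDl.
  have K1 : {in K :&: N & component A' x, forall u y, adj u y}.
    move=> u y /setIP[uK uN] yD; apply: (@hom (component A' x) u x) => //.
    - exact: component_connected.
    - exact: component_sub.
    - exact: component_refl.
    - by move/cliqueP: kK; apply=> //; apply: contraNneq xN => <-.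
  rewrite -(cardsID N K); have [[lt|nad] _] := hR x xA.
    (* The strict drop inside [D] passes to [K], since [K :&: N] joined to a largest clique of [D]
       is a clique of [A]. *)
    rewrite -ltnS; apply: leq_trans oA; rewrite -addnS.
    apply: leq_trans (_ : omega_in (K :&: N) + omega_in (component A' x) <= _)%N.
      apply: leq_add; last exact: leq_ltn_trans lt.
      by apply: omega_in_ge => //; apply: clique_sub kK _; exact: subsetIl.
    apply: omega_in_join => //; first by rewrite subIset // (subset_trans KC CA).
    by apply: subset_trans CA; apply: subset_trans (component_sub _ _) (subsetDl _ _).
  (* In the other case no vertex of [N :\: S] has a neighbour in [D], so [K] lies in [D]. *)
  have -> : K :&: N = set0.
    apply/setP => u; rewrite [RHS]inE; apply/negP => uKN; have /setIP[uK uN] := uKN.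
    have uS : u \in N :\: S.
      move/(subsetP KR): uK; rewrite in_setU => /orP[//|/(subsetP RA)].
      by rewrite inE uN.
    by have := nad u x uS (component_refl xA); rewrite K1 ?component_refl.
  rewrite cards0 add0n; apply: leq_trans o2 _.
  by apply: leq_trans (oD x xA); apply: omega_inS; exact: subsetIr.
have cR : colorable_in (A' :\: R) b.
  by apply: (@colorable_in_component A'); rewrite ?subsetDl // => x /hR[_]; rewrite setD_componentI.
apply: colorable_inS (colorable_inU cS cR) => //; apply/subsetP => x.
rewrite /A' !inE; case: (x \in C); case: (x \in S); case: (x \in R);
  by case: (adj v x).
Qed.

End PathFree.
End Graph.

(** * Clique-reducing sets in path-free graphs *)

Section PathFreeBounds.
Variable G : sgraph.
Implicit Types (A C D K N R X Y Z : {set G}) (u v x y : G) (s : seq G).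
Variable d : nat.
Hypothesis d2 : (2 <= d)%N.
Hypothesis nopath : forall s, induced_path s -> size s <> d.+3.

(** Unlike [reducible], this is hereditary in [Z], and the drop is relative to each subset's own
    clique number. *)
Definition strictly_reducible Z q (b : int) : Prop := forall X, X \subset Z -> X != set0 ->
  (omega_in X <= q)%N -> exists R : {set G},
    [/\ R \subset X, (omega_in R < omega_in X)%N & colorable_in (X :\: R) b].

Lemma strictly_reducible_step Z q (b c : int) : b <= c -> 0 <= c -> strictly_reducible Z q b ->
  (forall X, X \subset Z -> X != set0 -> connected_in X ->
     (omega_in X <= q.+1)%N -> reducible X q c) ->
  strictly_reducible Z q.+1 c.
Proof.
move=> bc c0 sr h X XZ X0 oX; have [oq|] := leqP (omega_in X) q.
  have [R [RX oR cR]] := sr X XZ X0 oq.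
  by exists R; split=> //; exact: colorable_inS cR.
move=> oX'; have [|R [RX oR cR]] := @reducible_component _ X q c c0.
  move=> x xX; apply: h.
  - exact: subset_trans (component_sub _ _) XZ.
  - by apply/set0Pn; exists x; exact: component_refl.
  - exact: component_connected.
  - by apply: leq_trans oX; exact: omega_inS (component_sub _ _).
by exists R; split=> //; exact: leq_ltn_trans oX'.
Qed.

(** This is the recurrence [F_k = F_(k-1) + B_k]: the reducing set takes [E] colours, its complement
    [b]. *)
Lemma colorable_in_step Z q (E b : int) : 0 <= b ->
  (forall X, X \subset Z -> (omega_in X <= q)%N -> colorable_in X E) ->
  strictly_reducible Z q.+1 b ->
  forall X, X \subset Z -> (omega_in X <= q.+1)%N -> colorable_in X (E + b).
Proof.
move=> b0 cE sr X XZ oX; have [X0|X0] := eqVneq X set0.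
  have [|E0 _] := cE set0 (sub0set _); first by rewrite omega_in0.
  by rewrite X0; apply: colorable_in0; exact: addr_ge0.
have [R [RX oR cR]] := sr X XZ X0 oX.
apply: colorable_inS (colorable_inU (cE R _ _) cR) => //.
- by apply/subsetP => x xX; rewrite !inE xX andbT orbN.
- exact: subset_trans XZ.
by rewrite -ltnS; exact: leq_trans oX.
Qed.

Lemma endgame_pred A q (b : int) : (omega_in A <= q.+1)%N -> 0 <= b -> strictly_reducible A q b ->
  endgame A q d b.
Proof.
move=> oA b0 sr v s C sd p fC vA CA vC cC nC; rewrite -[b]add0r.
apply: (@reducible_homogeneous G d nopath A q v s C set0) => //; first exact: sub0set.
  exact: colorable_in0.
move=> x D xA oD.
have [||R [RX oR cR]] := sr (component (C :\: nbr C v) x) _ _ oD.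
- by apply: subset_trans CA; apply: subset_trans (component_sub _ _) (subsetDl _ _).
- by apply/set0Pn; exists x; exact: component_refl.
by exists R => //; split=> //; left.
Qed.

(* The first vertex [x] of the path need not be in [Z]: only its neighbourhood
   in [Z] is paid, at the cost [E 0] instead of [E m]. *)
Lemma colorable_in_sparse_nbr Z r (E b : nat -> int) : (0 < r)%N ->
  (forall X, X \subset Z -> (omega_in X <= r)%N -> colorable_in X (E 0%N)) ->
  strictly_reducible Z r (b 0%N) -> 0 <= b 0%N ->
  {in Z, forall z, exists2 x, adj x z & (omega_in (nbr Z x) <= r)%N} ->
  (forall m, E m.+1 = E m + b m.+1) ->
  (forall m, b m.+1 = E 0%N + (d - 2)%:Z * E m + b m) ->
  forall m X, X \subset Z -> (omega_in X <= r + m)%N -> colorable_in X (E m).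
Proof.
move=> r0 cE0 sr0 b0 hZ eE eb m.
(* Colouring at level [m + 1] uses strict reducibility there, which in turn uses colouring and
   strict reducibility at level [m]. *)
suff [] : [/\ 0 <= b m, strictly_reducible Z (r + m) (b m) &
    forall X, X \subset Z -> (omega_in X <= r + m)%N -> colorable_in X (E m)] by [].
have E0 : 0 <= E 0%N by case: (cE0 set0 (sub0set _)); rewrite ?omega_in0.
elim: m => [|m [bm sr cE]]; first by rewrite addn0.
have Em : 0 <= E m by case: (cE set0 (sub0set _)); rewrite ?omega_in0.
have le : b m <= b m.+1 by rewrite eb lerDr addr_ge0 ?mulr_ge0.
have bm' := le_trans bm le.
have srm : strictly_reducible Z (r + m).+1 (b m.+1).
  apply: (strictly_reducible_step le bm' sr) => X XZ /set0Pn[z zX] cX oX.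
  have [x xz ox] := hZ z (subsetP XZ z zX).
  rewrite eb -addrA; apply: (@reducible_of_endgame G X _ d _ _ (E m) x) => //.
  - by rewrite addn_gt0 r0.
  - by move=> Y YX; apply: cE; exact: subset_trans XZ.
  - by apply: endgame_pred => // Y YX; apply: sr; exact: subset_trans XZ.
  - by right; apply/set0Pn; exists z; rewrite inE zX.
  apply: cE0; first by apply: subset_trans XZ; apply/subsetP => y; rewrite inE => /andP[].
  apply: leq_trans ox; apply: omega_inS; apply/subsetP => y.
  by rewrite !inE => /andP[/(subsetP XZ)-> ->].
by rewrite addnS; split=> //; rewrite eE; exact: colorable_in_step.
Qed.

Lemma endgame_split A q m r (Em b : int) : (omega_in A <= q.+1)%N -> (r + m = q)%N -> 0 <= b ->
  ((0 < m)%N -> strictly_reducible A m b) ->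
  (forall Z, Z \subset A -> (omega_in Z <= q)%N ->
    {in Z, forall z, exists2 x, adj x z & (omega_in (nbr Z x) <= r)%N} -> colorable_in Z Em) ->
  endgame A q d (b + Em).
Proof.
move=> oA rm b0 sr cE v s C sd p fC vA CA vC cC nC; rewrite addrC.
have NA : nbr C v \subset A.
  by apply: subset_trans CA; apply/subsetP => x; rewrite inE => /andP[].
set A' := C :\: nbr C v.
have A'A : A' \subset A by exact: subset_trans (subsetDl _ _) CA.
pose S := [set u in nbr C v | [exists y in A', adj u y && (m < omega_in (component A' y))%N]].
have SN : S \subset nbr C v by apply/subsetP => x; rewrite inE => /andP[].
apply: (@reducible_homogeneous G d nopath A q v s C S) => //.
  apply: cE; first exact: subset_trans NA.
    rewrite -ltnS; apply: leq_trans oA; apply: leq_ltn_trans (omega_in_nbr vA CA).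
    exact: omega_inS.
  move=> u; rewrite inE => /andP[uN /exists_inP[y yA /andP[uy oy]]].
  exists y; first by rewrite adj_sym.
  (* The component of [y] has clique number at least [m + 1] and is complete to [nbr S y], leaving
     at most [q - m = r] for the latter. *)
  rewrite -(leq_add2r m.+1) [(r + _)%N]addnS rm; apply: leq_trans oA.
  apply: leq_trans (_ : omega_in (nbr S y) + omega_in (component A' y) <= _)%N.
    by rewrite leq_add2l.
  apply: omega_in_join.
  - apply: subset_trans NA; apply: subset_trans SN; apply/subsetP => x.
    by rewrite inE => /andP[].
  - exact: subset_trans (component_sub _ _) A'A.
  move=> w z; rewrite inE => /andP[wS yw] zD.
  apply: (@homogeneous G d nopath v s C (component A' y) w y z sd p fC vC) => //.
  - exact: component_connected.
  - exact: component_sub.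
  - exact: subsetP wS.
  - exact: component_refl.
  - by rewrite adj_sym.
move=> x D xA' oD; have [big|small] := ltnP m (omega_in D).
  (* By the choice of [S], no vertex of the neighbourhood outside [S] sees this component, so it is
     kept whole. *)
  exists D; first exact: subxx.
  split; last by rewrite setDv; exact: colorable_in0.
  right=> u y; rewrite inE => /andP[uS uN] yD; apply: contraNN uS => uy.
  rewrite inE uN; apply/exists_inP; exists y; first exact: (subsetP (component_sub A' x)).
  by rewrite uy (component_eq yD).
have D0 : D != set0 by apply/set0Pn; exists x; exact: component_refl.
have [||R [RX oR cR]] := sr _ D _ D0 small.
- exact: leq_trans (omega_in_gt0 D0) small.
- exact: subset_trans (component_sub _ _) A'A.
by exists R => //; split=> //; left.
Qed.

Lemma endgame_T A q : (omega_in A <= q.+1)%N -> (0 < q)%N ->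
  (forall j, (j <= q)%N -> (forall X, (omega_in X <= j)%N -> colorable_in X (F d j)) /\
     strictly_reducible [set: G] j (B d j)) ->
  endgame A q d (T d q.+1).
Proof.
move=> oA q0 IH.
have srA j : (j <= q)%N -> strictly_reducible A j (B d j).
  by move=> jq X _; have [_ sr] := IH j jq; apply: sr; exact: subsetT.
apply: (@T_ind d (fun z => endgame A q d z)) => [||m mq] //.
  by apply: endgame_pred => //; [case: (FB_ge0 d2 q)|exact: srA].
set r := (q.+1 - m - 1)%N; have er : (q.+1 - m - 2 = r.-1)%N by lia.
have [cF _] := IH r ltac:(lia); have e := @FE d r ltac:(lia).
apply: (@endgame_split A q m r) => //; first by lia.
- by case: (FB_ge0 d2 m).
- by move=> _; apply: srA; lia.
move=> Z ZA oZ hZ; rewrite er.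
pose E j := L d j * F d r - p d j * F d r.-1.
(* For [j >= 1] this is [E j - E (j - 1)], with [p_(j-1)] eliminated by the recurrence. The form
   also makes sense at [j = 0], where it gives [F_r - F_(r-1) = B_r]. *)
pose b j := p d j.+1 * F d r - ((1 - d%:Z) * p d j + p d j.+1) * F d r.-1.
have E0 : E 0%N = F d r by rewrite /E /L big_nat1 /= mul1r mul0r subr0.
have b0 : b 0%N = B d r by rewrite /b /= mulr0 add0r !mul1r e; ring.
rewrite -/(E m); apply: (@colorable_in_sparse_nbr Z r E b _ _ _ _ hZ) => //.
- lia.
- by rewrite E0 => X _; exact: cF.
- by rewrite b0 => X _; have [_ sr] := IH r ltac:(lia); apply: sr; exact: subsetT.
- by rewrite b0; case: (FB_ge0 d2 r).
- by move=> j; rewrite /E /b LS pSS; ring.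
- move=> j; rewrite E0 /E /b -subzn //.
  have -> : (1 - d%:Z) * p d j.+1 + p d j.+2 = p d j.+1 - p d j by rewrite pSS; ring.
  have -> : p d j.+2 = p d j.+1 + (1 + (d%:Z - 2) * L d j).
    by rewrite -p_diff; ring.
  ring.
lia.
Qed.

Lemma colorable_in_F_reducible_B k : (forall X, (omega_in X <= k)%N -> colorable_in X (F d k)) /\
  strictly_reducible [set: G] k (B d k).
Proof.
elim/ltn_ind: k => k IH; case: k IH => [|q] IH.
  split=> [X|X _ /omega_in_gt0 h1 h2]; last by rewrite leqn0 in h2; rewrite (eqP h2) in h1.
  have [-> _|/omega_in_gt0 h1 h2] := eqVneq X set0; first exact: colorable_in0.
  by rewrite leqn0 in h2; rewrite (eqP h2) in h1.
have [Fq0 _] := FB_ge0 d2 q; have [_ Bq0] := FB_ge0 d2 q.+1.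
have [cF sr] := IH q (ltnSn _).
have srq : strictly_reducible [set: G] q.+1 (B d q.+1).
  case: (posnP q) => q0.
    (* Clique number one means no edges: one colour suffices with an empty reducing set. *)
    rewrite q0 => X _ X0 oX; exists set0.
    rewrite omega_in0 omega_in_gt0 // sub0set setD0; split=> //.
    split=> //; exists (fun=> 0%N); split=> // x y xX yX xy.
    have : (2 <= omega_in X)%N.
      have xny : x != y by apply: contraTneq xy => ->; rewrite adj_irrefl.
      have := @omega_in_ge _ X [set x; y]; rewrite cards2 xny; apply.
        by apply: cliqueU; [exact: clique1|exact: clique1|move=> a b /set1P-> /set1P->].
      by rewrite subUset !sub1set xX.
    by rewrite ltnNge oX.
  apply: (strictly_reducible_step (B_mono d2 q) Bq0 sr) => X _ /set0Pn[y yX] cX oX.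
  rewrite BE // -[q.+1.-1]/q.
  (* Of the [d - 1] neighbourhoods paid for, the first is that of the starting vertex [y]. *)
  have -> : (d%:Z - 1) * F d q + T d q.+1 = F d q + ((d - 2)%:Z * F d q + T d q.+1).
    by rewrite -subzn //; ring.
  apply: (@reducible_of_endgame G X q d _ _ _ y) => //.
  - by apply: (T_ge0 d2) => // j _; exact: FB_ge0.
  - by move=> Y _; exact: cF.
  - by apply: endgame_T => // j jq; apply: IH; rewrite ltnS.
  - by left.
  by apply: cF; rewrite -ltnS; apply: leq_trans oX; exact: omega_in_nbr.
split=> // X oX; rewrite FE //; apply: (@colorable_in_step [set: G] q) => // Y _; exact: cF.
Qed.

End PathFreeBounds.

(** * From vertex subsets to induced subgraphs *)

Lemma omega_in_induced (G : sgraph) (S : {set G}) : omega (induced S) = omega_in S.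
Proof.
apply/eqP; rewrite eqn_leq; apply/andP; split.
  apply/(bigop.bigmax_leqP _ _ _) => K kK.
  rewrite -(card_imset _ (val_inj : injective (val : {x | x \in S} -> G))).
  apply: omega_in_ge.
    apply/cliqueP => _ _ /imsetP[x xK ->] /imsetP[y yK ->] xy.
    by move/cliqueP: kK => /(_ x y xK yK); apply; apply: contraNneq xy => ->.
  by apply/subsetP => _ /imsetP[x _ ->]; exact: valP.
apply/omega_in_leP => K kK /subsetP KS.
pose K' : {set induced S} := [set x | val x \in K].
have -> : K = val @: K'.
  apply/setP => x; apply/idP/imsetP => [xK|[y]]; last by rewrite inE => ? ->.
  by exists (Sub x (KS x xK)); rewrite ?inE SubK.
rewrite (card_imset _ val_inj).
apply: (bigop.leq_bigmax_cond (F := fun K : {set induced S} => #|K|)).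
apply/cliqueP => x y; rewrite !inE => xK yK xy; move/cliqueP: kK; apply=> //.
Qed.

Lemma omega_setT (G : sgraph) : omega G = omega_in [set: G].
Proof. by apply: eq_bigl => K; rewrite subsetT andbT. Qed.

Lemma chi_le (G : sgraph) (c : G -> nat) (z : int) : 0 <= z ->
  (forall x, (c x)%:Z < z) -> (forall x y, adj x y -> c x != c y) -> (chi G)%:Z <= z.
Proof.
move=> z0 c1 c2; suff : colorable G `|z|%N.
  by rewrite /chi; case: ex_minnP => n _ h /h; lia.
have cz x : (c x < `|z|)%N by have := c1 x; lia.
apply/existsP; exists [ffun x => Ordinal (cz x)]; apply/forallP => x.
by apply/forallP => y; apply/implyP => /c2; rewrite !ffunE.
Qed.

Lemma chi_induced (G : sgraph) (S : {set G}) z : colorable_in S z -> (chi (induced S))%:Z <= z.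
Proof.
case=> z0 [c [c1 c2]]; apply: (@chi_le (induced S) (fun x => c (val x))) => // [x|x y].
  exact/c1/valP.
by apply: c2; exact: valP.
Qed.

Lemma induced_path_nth (G : sgraph) (x0 : G) s : induced_path s -> forall i j,
  (i < size s)%N -> (j < size s)%N ->
  (adj (nth x0 s i) (nth x0 s j) = (i.+1 == j) || (j.+1 == i)) /\
  (nth x0 s i = nth x0 s j -> i = j).
Proof.
elim: s => [|x [|y s] IH] //; first by move=> _ [|i] [|j] //; rewrite adj_irrefl.
move=> /andP[/andP[xy /allP xs] /IH{}IH].
have h j : (j < (size s).+1)%N ->
    adj x (nth x0 (y :: s) j) = (j == 0%N) /\ x <> nth x0 (y :: s) j.
  case: j => [|j] js /=; first by split=> [//|e]; rewrite -e adj_irrefl in xy.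
  have /andP[/eqP ? /negPf ?] := xs _ (mem_nth x0 (js : (j < size s)%N)).
  by split.
move=> [|i] [|j] //= is_ js_; first by rewrite adj_irrefl.
- by have [-> ne] := h j js_; split=> //; rewrite orbF eqSS eq_sym.
- have [e ne] := h i is_; rewrite adj_sym [adj _ _]e; split; first by rewrite eqSS eq_sym.
  by move/esym.
- have [e inj] := IH i j is_ js_; rewrite !eqSS; split=> // /inj->//.
Qed.

(** The position in [s] is an isomorphism from the subgraph induced on [s] to the path graph. *)
Lemma path_free_induced_path (G : sgraph) t : path_free t.+1 G ->
  forall s : seq G, induced_path s -> size s <> t.+1.
Proof.
move=> free s ps st.
have [x0 _] : exists x0 : G, true by case: s st {ps} => // x; exists x.
apply: (free [set x in s]).
have gP (i : 'I_t.+1) : nth x0 s i \in [set x in s] by rewrite inE mem_nth // st.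
pose g (i : path_graph t.+1) : induced [set x in s] := Sub (nth x0 s i) (gP i).
pose ix (x : induced [set x in s]) : 'I_t.+1 := inord (index (val x) s).
have xs (x : induced [set x in s]) : val x \in s by have := valP x; rewrite inE.
have ixE x : ix x = index (val x) s :> nat.
  by rewrite inordK // -st index_mem.
exists ix.
  exists g => [x|i].
    by apply: val_inj; rewrite SubK ixE nth_index.
  apply: ord_inj; rewrite ixE SubK.
  have li : (i < size s)%N by rewrite st.
  have l2 : (index (nth x0 s i) s < size s)%N by rewrite index_mem mem_nth.
  by have [_ inj] := induced_path_nth x0 ps l2 li; apply: inj; rewrite nth_index // mem_nth.
move=> x y; rewrite -[LHS]/(path_adj (ix x) (ix y)) -[RHS]/(adj (val x) (val y)).
rewrite /path_adj !ixE.
have [lx ly] : (index (val x) s < size s)%N /\ (index (val y) s < size s)%N.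
  by rewrite !index_mem.
have [<- _] := induced_path_nth x0 ps lx ly.
by rewrite !nth_index.
Qed.

Theorem theorem2 (t : nat) (ht : (5 <= t)%N) (G : sgraph) (k : nat)
  (hk : (1 <= k)%N) (hfree : path_free t G) (homega : omega G = k) :
  (exists2 R : {set G}, clique_reducing R & (chi (delete R))%:Z <= B (t - 3) k)
  /\ (chi G)%:Z <= F (t - 3) k.
Proof.
have d2 : (2 <= t - 3)%N by lia.
have nopath (s : seq G) : induced_path s -> size s <> (t - 3).+3.
  have et : (t - 3).+3 = t by lia.
  by apply: path_free_induced_path; rewrite et.
have [cF sr] := @colorable_in_F_reducible_B G (t - 3) d2 nopath k.
have oT : omega_in [set: G] = k by rewrite -omega_setT.
split; last first.
  have [F0 [c [c1 c2]]] := cF [set: G] ltac:(by rewrite oT).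
  by apply: (@chi_le G c) => // [x|x y]; [apply: c1|apply: c2].
have [|||R [_ oR cR]] := sr [set: G].
- exact: subxx.
- by apply: contraTneq hk => e; rewrite -oT e omega_in0.
- by rewrite oT.
exists R; first by rewrite /clique_reducing omega_in_induced omega_setT.
by apply: chi_induced; rewrite -setTD.
Qed.
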